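(* Let $D$ be a strong digraph of order $n\ge 4$. Suppose that every vertex $u$ of $D$ which belongs to a nonadjacent dominating pair or a nonadjacent dominated pair satisfies $d(u)\ge n$. Then $D$ contains a (directed) cycle of length $n-1$, unless $n$ is even and $D\in\mathcal{D}_B$, or $D=C_n$, the directed cycle on $n$ vertices (which belongs to $\mathcal{D}_L$).
   Context: All digraphs are finite, without loops and without multiple (parallel) arcs; a pair of opposite arcs $uv$, $vu$ (a $2$-cycle) is allowed. Paths and cycles are directed. The order of $D$ is $|V(D)|$. $D$ is strong if for any two vertices $x,y$ there is a directed path from $x$ to $y$ (a single vertex is strong). $d^+(u),d^-(u)$ are the out- and in-degree, $N^+(u),N^-(u)$ the out- and in-neighborhoods, and $d(u)=d^+(u)+d^-(u)$ is the total number of arcs incident with $u$. Two distinct vertices are adjacent if there is at least one arc between them, and nonadjacent otherwise. $D=C_n$ is meant up to isomorphism. A pair $\{x,y\}$ of distinct nonadjacent vertices is a nonadjacent dominated pair if $x,y$ have a common in-neighbor (some $z$ with arcs $zx$ and $zy$), and a nonadjacent dominating pair if they have a common out-neighbor (some $z$ with arcs $xz$ and $yz$). $\mathcal{D}_B$ is the class of balanced complete bipartite digraphs with at least $4$ vertices: the vertex set is partitioned into two independent sets of equal size, and for all $x,y$ in different parts both arcs $xy$ and $yx$ are present. The class $\mathcal{D}_L$ (used only in the parenthetical remark): A digraph is semicomplete if any two distinct vertices are adjacent. A locally semicomplete digraph (LSD) is a digraph in which the in-neighborhood of each vertex and the out-neighborhood of each vertex induce semicomplete digraphs. A local tournament is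 an LSD without $2$-cycles. A digraph on $m$ vertices is round if its vertices can be labelled $v_0,\dots,v_{m-1}$ so that for each $i$, $N^+(v_i)=\{v_{i+1},\dots,v_{i+d^+(v_i)}\}$ and $N^-(v_i)=\{v_{i-d^-(v_i)},\dots,v_{i-1}\}$, subscripts modulo $m$. For a local tournament $R$ with vertices $v_1,\dots,v_r$ and strong semicomplete digraphs $S_1,\dots,S_r$, $R[S_1,\dots,S_r]$ denotes the digraph obtained from $R$ by replacing each $v_i$ by $S_i$ and each arc $v_iv_j$ by all arcs from $V(S_i)$ to $V(S_j)$. The girth $g(R)$ is the length of a shortest cycle in $R$. $\mathcal{D}_L$ is the class of strong LSDs of the form $R[S_1,\dots,S_r]$ where $R$ is a round local tournament, each $S_i$ is a strong semicomplete digraph, and $g(R)>\max\{2,|V(S_1)|,\dots,|V(S_r)|\}+1$. *)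

(* Defs.v *)
From mathcomp Require Import all_boot.

Set Implicit Arguments.
Unset Strict Implicit.
Unset Printing Implicit Defensive.

(* A digraph is a relation e : rel T on a finType T, with e x y meaning that
   xy is an arc.  This excludes parallel arcs and allows 2-cycles; the absence
   of loops is the separate hypothesis irreflexive e. *)

Section Digraph.
Variables (T : finType) (e : rel T).

Definition out_nbr (u : T) : {set T} := [set v | e u v].
Definition in_nbr (u : T) : {set T} := [set v | e v u].
Definition outdeg (u : T) : nat := #|out_nbr u|.
Definition indeg (u : T) : nat := #|in_nbr u|.
Definition deg (u : T) : nat := outdeg u + indeg u.

Definition adjacent (x y : T) : bool := e x y || e y x.

Definition strong : Prop := forall x y, connect e x y.

(* path.cycle also accepts the empty sequence, hence the bound on the size;
   a cycle of a loopless digraph has length at least 2. *)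
Definition dicycle (c : seq T) : Prop := [/\ 1 < size c, cycle e c & uniq c].

Definition has_cycle_of_length (k : nat) : Prop :=
  exists2 c : seq T, dicycle c & size c = k.

(* A digraph without cycles has no girth. *)
Definition is_girth (g : nat) : Prop :=
  has_cycle_of_length g /\ (forall c, dicycle c -> g <= size c).

Definition nonadjacent_dominated_pair (x y : T) : Prop :=
  [/\ x != y, ~~ adjacent x y & exists z, e z x /\ e z y].

Definition nonadjacent_dominating_pair (x y : T) : Prop :=
  [/\ x != y, ~~ adjacent x y & exists z, e x z /\ e y z].

Definition independent (A : {set T}) : Prop :=
  {in A &, forall x y, ~~ e x y}.

Definition induces_semicomplete (A : {set T}) : Prop :=
  {in A &, forall x y, x != y -> adjacent x y}.

Definition semicomplete : Prop := induces_semicomplete [set: T].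

Definition locally_semicomplete : Prop :=
  forall x, induces_semicomplete (in_nbr x) /\ induces_semicomplete (out_nbr x).

Definition local_tournament : Prop :=
  locally_semicomplete /\ (forall x y, ~~ (e x y && e y x)).

Definition round : Prop :=
  exists v : 'I_#|T| -> T, bijective v /\
  forall i j : 'I_#|T|,
    (e (v i) (v j) <->
       exists2 k, 0 < k <= outdeg (v i) & j = i + k %[mod #|T|]) /\
    (e (v j) (v i) <->
       exists2 k, 0 < k <= indeg (v i) & j + k = i %[mod #|T|]).

Definition in_DB : Prop :=
  4 <= #|T| /\
  exists A : {set T},
    [/\ #|A| = #|~: A|, independent A, independent (~: A)
      & forall x y, x \in A -> y \notin A -> e x y /\ e y x].

End Digraph.

Definition isomorphic (T U : finType) (e : rel T) (e' : rel U) : Prop :=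
  exists f : T -> U, bijective f /\ forall x y, e x y = e' (f x) (f y).

Definition directed_cycle (n : nat) : rel 'I_n := fun i j => j == ordS i.

(* R[S_1, ..., S_r]: the vertex set is the disjoint union of the S_i; when x
   and y lie in the same S_i, tagged_as x y is y seen in the type of x. *)
Definition composition (r : nat) (R : rel 'I_r) (S : 'I_r -> finType)
    (s : forall i, rel (S i)) : rel {i : 'I_r & S i} :=
  fun x y => if tag x == tag y then s (tag x) (tagged x) (tagged_as x y)
             else R (tag x) (tag y).

Definition in_DL (T : finType) (e : rel T) : Prop :=
  [/\ strong e, locally_semicomplete e &
    exists (r : nat) (R : rel 'I_r) (S : 'I_r -> finType)
           (s : forall i, rel (S i)) (g : nat),
      [/\ irreflexive R, round R & local_tournament R] /\
      (forall i, [/\ 0 < #|S i|, irreflexive (s i), strong (s i)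
                   & semicomplete (s i)]) /\
      [/\ is_girth R g, (maxn 2 (\max_(i < r) #|S i|)).+1 < g
        & isomorphic e (composition R s)]].

(* Main.v *)
Require Import Defs.
From mathcomp Require Import all_boot zify.
From Stdlib Require Import Classical_Prop.

(** Let C be a cycle of length m <= n - 2 and suppose that no cycle has length
    strictly between m and n.  As D is strong, C has a bypass: a walk outside C
    from a vertex of C to a (possibly equal) vertex of C; take one that jumps
    over the fewest vertices of C.  If it jumps over a nonempty segment X, the
    first vertex u of the walk is nonadjacent to all of X, and no path of length
    2 outside C joins u and X.  Counting the arcs at u and at x in X then shows
    that a vertex x of degree at least n can be inserted into the rest of C; a
    vertex x of smaller degree can be inserted too, since its adjacencies
    propagate along C and would otherwise reach an end of the bypass, making x a
    member of a dominated or dominating pair.  Reinserting all of X, or all of X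
    but one vertex, next to the bypass gives a cycle of forbidden length.

    So the bypass u ... v joins consecutive vertices of C, and it covers all
    vertices outside C.  The same propagation shows that u and v have degree at
    least n, hence exactly m arcs to C each; the forbidden lengths then force
    the arcs between C and u, v to alternate and the bypass to be the 2-cycle
    uv.  Exchanging the vertices of C one by one with u or v, and repeating the
    argument, yields the complete bipartite digraph.  If finally every cycle has
    length n, the arcs are those of one Hamiltonian cycle. *)

Set Implicit Arguments.
Unset Strict Implicit.
Unset Printing Implicit Defensive.

(** * Lists and closed walks *)

Section Sequences.
Variable T : eqType.
Implicit Types (s t : seq T) (P Q : pred T) (r : rel T).

Lemma count_disjoint P Q s :
  {in s, forall x, P x -> ~~ Q x} -> count P s + count Q s <= size s.
Proof.
move=> dPQ; rewrite -(count_predC P) leq_add2l; elim: s dPQ => //= x s IHs dPQ.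
apply: leq_add; last by apply: IHs => y ys; apply: dPQ; rewrite inE ys orbT.
have := dPQ x (mem_head _ _); case: (P x) => //=.
  by move/(_ isT); case: (Q x).
by case: (Q x).
Qed.

Lemma split_last P s : has P s ->
  exists s1 y s2, [/\ s = s1 ++ y :: s2, P y & ~~ has P s2].
Proof.
elim: s => //= x s IHs; case: (boolP (has P s)) => [/IHs|nPs].
  by case=> s1 [y [s2 [-> Py nP]]]; exists (x :: s1), y, s2.
by rewrite orbF => Px; exists [::], x, s.
Qed.

Lemma mem_split s x : x \in s -> exists s1 s2, s = s1 ++ x :: s2.
Proof. by case/splitPr => s1 s2; exists s1, s2. Qed.

Lemma mem_split_path s x y : x \in y :: s ->
  exists s1 s2, s = s1 ++ s2 /\ last y s1 = x.
Proof. by case/splitPl => s1 s2; exists s1, s2. Qed.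

Lemma cycle_cat_cons r s x t : cycle r (s ++ x :: t) ->
  path r x t /\ path r (last x t) (rcons s x).
Proof.
rewrite -(rot_cycle (size s)) rot_size_cat /= rcons_cat cat_path.
by move/andP.
Qed.

Lemma cycle_all P s x :
  cycle (fun a b => P a ==> P b) s -> x \in s -> P x -> {in s, forall y, P y}.
Proof.
move=> + sx Px; case: (rot_to sx) => i t def_s.
rewrite -(rot_cycle i) def_s => /= ct y; rewrite -(mem_rot i) def_s.
have{ct}: path (fun a b => P a ==> P b) x t by move: ct; rewrite rcons_path => /andP[].
elim: t x {sx def_s} Px => [|z t IHt] x Px /=; first by rewrite inE => _ /eqP->.
case/andP=> /implyP/(_ Px) Pz pt; rewrite inE => /predU1P[-> //|].
exact: IHt Pz pt.
Qed.

Lemma cycle_pred r s x : cycle r s -> x \in s -> exists2 y, y \in s & r y x.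
Proof.
move=> + sx; have [i t def_s] := rot_to sx.
rewrite -(rot_cycle i) def_s /= rcons_path => /andP[_ rx].
by exists (last x t); rewrite // -(mem_rot i) def_s mem_last.
Qed.

Lemma rot_cycleP r s : 1 < size s ->
  (forall i a b t, rot i s = a :: b :: t -> r a b) -> uniq s -> cycle r s.
Proof.
move=> s_gt1 rP Us; apply: cycle_from_next => // x sx.
have [i t def_s] := rot_to sx.
case: t def_s => [|b t] def_s; first by move: s_gt1; rewrite -(size_rot i) def_s.
by rewrite -(next_rot i) // def_s /= eqxx; apply: rP def_s.
Qed.

End Sequences.

(** * Arc counts, and insertion into paths and cycles *)

Section Digraphs.
Variables (T : finType) (e : rel T).
Implicit Types (s t cs us ws xs C : seq T) (a b c u v w x y z : T).

Definition arcs u s := count (e u) s + count (e^~ u) s.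

Lemma arcs_cat u s t : arcs u (s ++ t) = arcs u s + arcs u t.
Proof. by rewrite /arcs !count_cat addnACA. Qed.

Lemma arcs_cons u x s : arcs u (x :: s) = e u x + e x u + arcs u s.
Proof. by rewrite /arcs /= addnACA. Qed.

Lemma arcs_perm u s t : perm_eq s t -> arcs u s = arcs u t.
Proof. by move=> /permP pst; rewrite /arcs !pst. Qed.

Lemma leq_arcs u s : arcs u s <= (size s).*2.
Proof. by rewrite -addnn leq_add ?count_size. Qed.

Lemma deg_arcs u s : perm_eq s (enum T) -> deg e u = arcs u s.
Proof.
move/arcs_perm->; rewrite /deg /outdeg /indeg /arcs.
by rewrite !cardsE !cardE !size_filter !enumT.
Qed.

(* [path (gap u) a s] says that [u] cannot be inserted between two consecutive
   vertices of the path [a :: s]. *)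
Definition gap u : rel T := fun a b => ~~ (e a u && e u b).

(** Each consecutive pair [x], [y] carries at most one of the arcs [x -> u] and [u -> y]. These
    pairs account for every arc at [u] except the one to the first vertex and the one from the
    last. *)
Lemma arcs_gap_path u a s : path (gap u) a s ->
  arcs u (a :: s) <= size s + e u a + e (last a s) u.
Proof.
elim: s a => [|b s IHs] a; first by rewrite arcs_cons /arcs /=; lia.
rewrite [path _ _ _]/= => /andP[gab /IHs IH]; rewrite arcs_cons /=.
have: e a u + e u b <= 1 by move: gab; rewrite /gap; do 2!case: (e _ _).
lia.
Qed.

Lemma arcs_gap_cycle u s : cycle (gap u) s -> arcs u s <= size s.
Proof.
case: s => [|a s]; first by rewrite /arcs.
rewrite /= rcons_path => /andP[/arcs_gap_path ps gl].
have: e (last a s) u + e u a <= 1 by move: gl; rewrite /gap; do 2!case: (e _ _).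
lia.
Qed.

(** When the cycle is opened between [a] and [b], [arcs_gap_path] bounds the count by [size s - 1]
    plus the arcs [a -> u] and [u -> b]. Hence at least one of these is present, and [gap] forbids
    both. *)
Lemma arcs_full_cycle u s : 1 < size s -> uniq s -> cycle (gap u) s ->
  size s <= arcs u s -> cycle (fun a b => e u b == ~~ e a u) s.
Proof.
move=> s_gt1 Us gs full; apply: rot_cycleP => // i a b t def_s.
move: gs; rewrite -(rot_cycle i) def_s /= => /andP[gab /arcs_gap_path].
have def_s' : rot 1 (rot i s) = b :: rcons t a by rewrite def_s rot1_cons.
rewrite last_rcons -def_s' (arcs_perm _ (permEl (perm_rot _ _))).
rewrite (arcs_perm _ (permEl (perm_rot _ _))).
rewrite -[size (rcons t a)]/(size (b :: rcons t a)).-1.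
rewrite -def_s' !size_rot; move: gab s_gt1 full; rewrite /gap; clear.
by case: (e a u); case: (e u b) => //=; lia.
Qed.

Lemma not_gap_path u a s : ~~ path (gap u) a s ->
  exists s1 x y s2, [/\ a :: s = s1 ++ x :: y :: s2, e x u & e u y].
Proof.
elim: s a => //= b s IHs a; rewrite negb_and negbK => /orP[/andP[au ub]|/IHs].
  by exists [::], a, b, s.
by case=> s1 [x [y [s2 [-> xu uy]]]]; exists (a :: s1), x, y, s2.
Qed.

Lemma cycle_glue c cs u us : path e c cs -> path e (last c cs) (u :: us) ->
  e (last u us) c -> cycle e ((c :: cs) ++ u :: us).
Proof. by move=> pc pu vc; rewrite /= rcons_path cat_path pc pu last_cat. Qed.

(* The longest prefix of [s] that ends at a vertex insertable at the same place as
   the head of [s] goes there as a block; this leaves all other places free. *)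
Lemma multi_insertion s t :
    sorted e s -> sorted e t -> {in s, forall y, ~~ sorted (gap y) t} ->
  exists t', [/\ sorted e t', perm_eq t' (s ++ t),
     forall x, head x t' = head x t & forall x, last x t' = last x t].
Proof.
have [k] := ubnP (size s); elim: k s t => // k IHk [|x s] t; first by exists t.
move=> le_k ps pt ins.
have ex_pq: exists s1 p q s2, [/\ t = s1 ++ p :: q :: s2, e p x & e x q].
  have := ins _ (mem_head _ _); case: {+}t => // a t'.
  exact: not_gap_path.
case: ex_pq => s1 [p [q [s2 [def_t px xq]]]].
have [|r1 [y [r2 [def_s gy gr2]]]] :=
    @split_last T (fun z => ~~ gap z p q) (x :: s).
  by rewrite /= /gap px xq.
pose t1 := s1 ++ p :: r1 ++ y :: q :: s2.
have yq: e y q by move: gy; rewrite negbK => /andP[].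
have pr1: path e p (rcons r1 y).
  move: ps; rewrite def_s; case: (r1) def_s => [|x' r] [def_x _] /=.
    by rewrite -def_x px.
  by rewrite -def_x px cat_path rcons_path /= => /andP[-> /andP[]].
have pt1: sorted e t1.
  move: pt; rewrite /t1 def_t !sorted_cat_cons /= => /and3P[-> _ qs2].
  by rewrite -cat_rcons cat_path pr1 /= last_rcons yq.
case: (IHk r2 t1) => //.
- by move: le_k; rewrite def_s size_cat /=; clear; lia.
- by move: ps; rewrite def_s sorted_cat_cons => /andP[_ /path_sorted].
(* The only place of [t] lost in [t1] is the one between [p] and [q], and [z] does not fit there
   because [y] is the last vertex that does. *)
- move=> z r2z; apply: contra (ins z _); last by rewrite def_s mem_cat inE r2z !orbT.
  have gz: gap z p q by apply: contraNT gr2 => ?; apply/hasP; exists z.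
  rewrite /t1 def_t !sorted_cat_cons /= gz => /andP[-> /=].
  by rewrite cat_path /= => /and4P[].
move=> t' [st' pt' ht' lt']; exists t'; split=> //.
- apply: (perm_trans pt'); rewrite /t1 def_t def_s.
  by apply/permP => P; rewrite !count_cat /= !count_cat /=; clear; lia.
- by move=> z; rewrite ht' /t1 def_t; case: (s1).
by move=> z; rewrite lt' /t1 def_t !(last_cat, last_cons).
Qed.

End Digraphs.

(** * Consequences of the degree condition, and bypasses *)

Section DegreeCondition.
Variables (T : finType) (e : rel T).
Implicit Types (s t cs us ws xs C : seq T) (a b c u v w x y z : T).

Hypothesis loopless : irreflexive e.
Hypothesis degree_cond : forall u : T,
  (exists v : T, nonadjacent_dominating_pair e u v \/
                 nonadjacent_dominated_pair e u v) -> #|T| <= deg e u.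

Definition big u := #|T| <= deg e u.

Lemma dominated_big z u y :
  e z u -> e z y -> u != y -> ~~ adjacent e u y -> big u.
Proof.
by move=> zu zy uy nuy; apply: degree_cond; exists y; right; split=> //; exists z.
Qed.

Lemma dominating_big z u y :
  e u z -> e y z -> u != y -> ~~ adjacent e u y -> big u.
Proof.
by move=> uz yz uy nuy; apply: degree_cond; exists y; left; split=> //; exists z.
Qed.

(** If [a -> u] and [a -> b], then [u] and [b] are dominated by [a], so a small [u] is adjacent to
    [b]. As [gap] excludes [u -> b], the arc [b -> u] is present, and so on along the path. *)
Lemma small_gap_last u a s : ~~ big u -> u \notin a :: s ->
  path e a s -> path (gap e u) a s -> e a u -> e (last a s) u.
Proof.
move=> su; elim: s a => //= b s IHs a; rewrite inE negb_or => /andP[ua us].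
case/andP=> ab ps /andP[gab gs] au; apply: IHs => //.
apply: contraNT su => nbu; apply: (dominated_big au ab).
  by move: us; rewrite inE negb_or => /andP[].
by rewrite /adjacent (negPf nbu) orbF; move: gab; rewrite /gap au.
Qed.

(** The mirror image: arcs from [u] propagate backwards, through dominating pairs. *)
Lemma small_gap_head u a s : ~~ big u -> u \notin a :: s ->
  path e a s -> path (gap e u) a s -> e u (last a s) -> e u a.
Proof.
move=> su; elim: s a => //= b s IHs a; rewrite inE negb_or => /andP[ua us].
case/andP=> ab ps /andP[gab gs] ul; have ub := IHs b us ps gs ul.
apply: contraNT su => nua; apply: (dominating_big ub ab ua).
by rewrite /adjacent (negPf nua); move: gab; rewrite /gap ub andbT.
Qed.

Lemma insert_cycle C u : cycle e C -> uniq C -> u \notin C -> 0 < size C ->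
  ~~ cycle (gap e u) C -> has_cycle_of_length e (size C).+1.
Proof.
case: C => // a s cC UC uC _ nC.
(* The cycle is opened into a walk from [a] to a second copy of [a]. Insertion keeps both ends, so
   the result closes up again. *)
have [|||t' [st' pt' ht' lt']] := @multi_insertion T e [:: u] (a :: rcons s a) => //.
  by move=> y; rewrite inE => /eqP->.
case: t' st' pt' ht' lt' => [|b t'].
  by move=> _ /perm_size.
case/lastP: t' => [|t' d] st' pt' ht' lt'.
  by have /perm_size := pt'; rewrite /= size_rcons.
have ba: b = a by have /= := ht' a.
have da: d = a by have := lt' a; rewrite /= !last_rcons.
subst b d.
have pt: perm_eq (a :: t') (u :: a :: s).
  rewrite -(perm_cons a); apply: perm_trans (_ : perm_eq _ (a :: rcons t' a)) _.
    by rewrite perm_cons perm_sym perm_rcons.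
  apply: (perm_trans pt'); rewrite /= -[u :: a :: _]/([:: u; a] ++ rcons s a).
  by apply/permP => P; rewrite /= -cats1 count_cat /=; clear; lia.
exists (a :: t'); last by rewrite (perm_size pt).
split; last by rewrite (perm_uniq pt) cons_uniq uC.
  by rewrite (perm_size pt).
by [].
Qed.

(** Otherwise the degrees of [u] and [x] sum to less than [2 * #|T|]. A vertex outside contributes
    at most 2, as it lies on no 2-path between them. The segment [xs] contributes at most
    [2 * (size xs - 1)], all from [x], and the path [c :: cs] at most [2 * (size cs + 2)]. *)
Lemma bypass_count xs c cs u x :
    uniq (u :: xs ++ c :: cs) -> x \in xs -> big u -> big x ->
    {in xs, forall y, ~~ adjacent e u y} -> path (gap e u) c cs ->
    (forall w, w \notin xs ++ c :: cs ->
       ~~ (e x w && e w u) /\ ~~ (e u w && e w x)) ->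
  ~~ path (gap e x) c cs.
Proof.
set C := xs ++ c :: cs => UuC xs_x bu bx nu gu n2.
apply/negP => gx; pose rs := [seq w <- enum T | w \notin u :: C].
have perm_T: perm_eq (rs ++ u :: C) (enum T).
  apply: uniq_perm; last 1 first.
  - move=> w; rewrite mem_cat mem_filter mem_enum andbT /=.
    by case: (w \in u :: C).
  - rewrite cat_uniq filter_uniq ?enum_uniq // UuC andbT.
    by apply/hasPn => w wC; rewrite mem_filter wC.
  exact: enum_uniq.
have := perm_size perm_T; rewrite -cardE size_cat /= /C size_cat /= => szT.
have arcsE y : deg e y =
    arcs e y rs + (e y u + e u y + (arcs e y xs + arcs e y (c :: cs))).
  by rewrite (deg_arcs e _ perm_T) arcs_cat arcs_cons /C arcs_cat.
move: bu bx; rewrite /big !arcsE loopless.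
have: arcs e u xs = 0.
  apply/eqP; rewrite addn_eq0 !eqn0Ngt -!has_count.
  apply/andP; split; apply/hasPn => y /nu; apply: contra.
    by rewrite /adjacent => ->.
  by rewrite /adjacent orbC => ->.
have [xu ux]: e x u = false /\ e u x = false.
  by have := nu _ xs_x; rewrite negb_or => /andP[/negPf-> /negPf->].
rewrite xu ux => ->.
have: arcs e x xs <= (size xs).-1.*2.
  case/splitPr: xs_x => x1 x2; rewrite arcs_cat arcs_cons loopless size_cat /=.
  by have := leq_arcs e x x1; have := leq_arcs e x x2; lia.
have: arcs e u rs + arcs e x rs <= (size rs).*2.
  rewrite /arcs -addnn.
  have rsC w : w \in rs -> w \notin C.
    by rewrite mem_filter inE negb_or -andbA => /and3P[].
  have: count (e u) rs + count (e^~ x) rs <= size rs.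
    apply: count_disjoint => w /rsC/n2[_]; rewrite negb_and => /orP[/negPf->//|//].
  have: count (e x) rs + count (e^~ u) rs <= size rs.
    apply: count_disjoint => w /rsC/n2[+ _]; rewrite negb_and => /orP[/negPf->//|//].
  by clear; lia.
have := arcs_gap_path gu; have := arcs_gap_path gx.
have: 0 < size xs by case: (xs) xs_x.
by move: szT; clear; do 4!case: (e _ _) => /=; lia.
Qed.

(* [xs ++ c :: cs] is the cycle [C], rotated so that the walk [u :: us] outside
   [C] leaves it at its last vertex [last c cs] and comes back at [c]; it jumps
   over [xs].  For [cs = [::]] the walk comes back where it left. *)
Definition bypass xs c cs u us :=
  [/\ cycle e (xs ++ c :: cs), uniq (xs ++ c :: cs),
      path e (last c cs) (u :: us), e (last u us) c &
      {in u :: us, forall w, w \notin xs ++ c :: cs}].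

Lemma bypass_prefix xs1 x xs2 c cs u us w ws :
    bypass (xs1 ++ x :: xs2) c cs u us ->
    path e (last c cs) (w :: ws) -> e (last w ws) x ->
    {in w :: ws, forall z, z \notin (xs1 ++ x :: xs2) ++ c :: cs} ->
  bypass xs1 x (xs2 ++ c :: cs) w ws.
Proof.
case=> cC UC _ _ _ pw wx wC; have defC := catA xs1 (x :: xs2) (c :: cs).
by split; rewrite -/cat ?last_cat /= ?defC.
Qed.

(** The walk leaves from inside the segment, so the cycle is rotated to make [x] its last vertex. *)
Lemma bypass_suffix xs1 x xs2 c cs u us w ws :
    bypass (xs1 ++ x :: xs2) c cs u us ->
    path e x (w :: ws) -> e (last w ws) c ->
    {in w :: ws, forall z, z \notin (xs1 ++ x :: xs2) ++ c :: cs} ->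
  bypass xs2 c (cs ++ rcons xs1 x) w ws.
Proof.
case=> cC UC _ _ _ pw wx wC.
have defC : rot (size xs1).+1 ((xs1 ++ x :: xs2) ++ c :: cs) =
            xs2 ++ c :: cs ++ rcons xs1 x.
  by rewrite -(cat_rcons x xs1) -catA -(size_rcons xs1 x) rot_size_cat -catA.
rewrite /bypass -defC rot_cycle rot_uniq last_cat last_rcons; split=> //.
by move=> z /wC; rewrite mem_rot.
Qed.

Lemma bypass_uniq xs c cs u us : bypass xs c cs u us ->
  exists w ws, bypass xs c cs w ws /\ uniq (w :: ws).
Proof.
case=> cC UC pu vc usC; have := usC _ (mem_last _ _); move: vc.
rewrite -[last u us]/(last (last c cs) (u :: us)).
case/shortenP: pu => [[|w ws] pw].
  by move=> _ _ _ /=; rewrite mem_cat mem_last orbT.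
by case/andP=> _ Uw sub wc _; exists w, ws; split=> //; split=> // z /sub/usC.
Qed.

Lemma bypass_cycle xs c cs u us : bypass xs c cs u us -> uniq (u :: us) ->
  has_cycle_of_length e (size (c :: cs) + size (u :: us)).
Proof.
case=> cC UC pu vc uusC Uu; have [pcs _] := cycle_cat_cons cC.
exists ((c :: cs) ++ u :: us); last by rewrite size_cat.
split; [by rewrite size_cat /= addnS | exact: cycle_glue |].
move: UC; rewrite !cat_uniq Uu => /and3P[_ _ ->]; rewrite andbT.
by apply/hasPn => z /uusC; rewrite mem_cat negb_or => /andP[].
Qed.

(** * A minimal bypass jumps over nothing *)

Section MinimalBypass.
Variables (xs cs us : seq T) (c u : T).
Let C := xs ++ c :: cs.
Hypothesis two_outside : (size C).+2 <= #|T|.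
Hypothesis bypassC : bypass xs c cs u us.
Hypothesis minimal : forall xs' c' cs' u' us',
  bypass xs' c' cs' u' us' -> size (xs' ++ c' :: cs') = size C ->
  size xs <= size xs'.
Hypothesis no_cycle : forall k,
  size C < k < #|T| -> ~ has_cycle_of_length e k.

Let minimal_prefix xs1 x xs2 w ws : xs = xs1 ++ x :: xs2 ->
  path e (last c cs) (w :: ws) -> e (last w ws) x ->
  {in w :: ws, forall z, z \notin C} -> False.
Proof.
move=> def_xs pw wx wC; move: bypassC wC minimal; rewrite /C def_xs => bC wC mC.
have := mC _ _ _ _ _ (bypass_prefix bC pw wx wC); rewrite !size_cat /= !size_cat /=.
by clear; lia.
Qed.

Let minimal_suffix xs1 x xs2 w ws : xs = xs1 ++ x :: xs2 ->
  path e x (w :: ws) -> e (last w ws) c ->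
  {in w :: ws, forall z, z \notin C} -> False.
Proof.
move=> def_xs pw wx wC; move: bypassC wC minimal; rewrite /C def_xs => bC wC mC.
have := mC _ _ _ _ _ (bypass_suffix bC pw wx wC).
by rewrite !size_cat /= !size_cat size_rcons /=; clear; lia.
Qed.

Let uC : u \notin C.
Proof. by case: bypassC => _ _ _ _ ->; rewrite ?mem_head. Qed.

Let vC : last u us \notin C.
Proof. by case: bypassC => _ _ _ _ ->; rewrite ?mem_last. Qed.

(** An arc from [u] to [x] would return to the cycle too early, and an arc from [x] to [u] would
    leave it later; either way fewer vertices are jumped over. *)
Let u_nonadj : {in xs, forall x, ~~ adjacent e u x}.
Proof.
case: bypassC => _ _ /= /andP[au pu] vc uusC x /mem_split[xs1 [xs2 def_xs]].
apply/norP; split; apply/negP.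
  move=> ux; apply: (minimal_prefix def_xs (w := u) (ws := [::])) => //=.
    by rewrite au.
  by move=> z; rewrite inE => /eqP->.
move=> xu; apply: (minimal_suffix def_xs (w := u) (ws := us)) => //=.
by rewrite xu.
Qed.

Let v_nonadj : {in xs, forall x, ~~ adjacent e (last u us) x}.
Proof.
case: bypassC => _ _ pu vc uusC x /mem_split[xs1 [xs2 def_xs]].
apply/norP; split; apply/negP.
  by move=> vx; apply: (minimal_prefix def_xs pu vx uusC).
move=> xv; apply: (minimal_suffix def_xs (w := last u us) (ws := [::])) => //=.
  by rewrite xv.
by move=> z; rewrite inE => /eqP->.
Qed.

(** Such a path would shorten the jump as well. Bypasses may repeat vertices, so it does not matter
    whether [w] lies on [u :: us]. *)
Let no_2path : {in xs, forall x w, w \notin C ->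
  ~~ (e x w && e w u) /\ ~~ (e u w && e w x)}.
Proof.
case: bypassC => _ _ /= /andP[au pu] vc uusC x /mem_split[xs1 [xs2 def_xs]] w wC.
split; apply/negP => /andP[].
  move=> xw wu; apply: (minimal_suffix def_xs (w := w) (ws := u :: us)) => //=.
    by rewrite xw wu.
  by move=> z; rewrite inE => /predU1P[->|/uusC].
move=> uw wx; apply: (minimal_prefix def_xs (w := u) (ws := [:: w])) => //=.
  by rewrite au uw.
by move=> z; rewrite !inE => /orP[] /eqP->.
Qed.

Let gap_u : path (gap e u) c cs.
Proof.
case: bypassC => cC UC _ _ _.
suff: cycle (gap e u) C by case/cycle_cat_cons.
have C_gt0 : 0 < size C by rewrite /C size_cat /= addnS.
apply: contraT => nC; case: (no_cycle _ (insert_cycle cC UC uC C_gt0 nC)).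
by rewrite leqnn.
Qed.

Hypothesis xs_gt0 : 0 < size xs.

(** The first vertex of [xs] and [u] form a dominated pair, with common in-neighbor [last c cs]. *)
Let big_u : big u.
Proof.
case: bypassC => cC _ /= /andP[au _] _ _.
have [x [xs' def_xs]]: exists x xs', xs = x :: xs'.
  by case: (xs) xs_gt0 => // x xs'; exists x, xs'.
have xs_x : x \in xs by rewrite def_xs mem_head.
case: (cycle_cat_cons cC) => _; rewrite {1}def_xs => /= /andP[ax _].
apply: (dominated_big au ax); last exact: u_nonadj.
by apply: contraNneq uC => ->; rewrite mem_cat xs_x.
Qed.

(** For big [x] this is [bypass_count]. For small [x], induction along [xs] inserts the predecessor
    [y] between some [p] and [q]; then [y] dominates [x] and [q], so these are adjacent. Without a
    place for [x], the adjacency propagates to [x -> c] or to [last c cs -> x], and [x] forms a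
    dominating pair with [last u us] or a dominated pair with [u]. *)
Let insertable : {in xs, forall x, ~~ path (gap e x) c cs}.
Proof.
case: bypassC => cC UC /= /andP[au _] vc _.
have [pcs] := cycle_cat_cons cC.
have adjC x y : adjacent e x y = adjacent e y x by rewrite /adjacent orbC.
have outside x w : x \in xs -> w \notin C -> x != w.
  by move=> xs_x; apply: contraNneq => <-; rewrite mem_cat xs_x.
have disj x y : x \in xs -> y \in c :: cs -> y != x.
  move: UC; rewrite cat_uniq => /and3P[_ /hasPn dis _] xs_x /dis.
  by apply: contraNneq => ->.
suff ins xs1 : forall x xs2, xs = xs1 ++ x :: xs2 ->
    path e (last c cs) (rcons xs c) -> ~~ path (gap e x) c cs.
  by move=> p x /mem_split[xs1 [xs2 /ins]]; apply.
elim/last_ind: xs1 => [|xs1 y IH] x xs2 def_xs pxs;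
  have xs_x: x \in xs by rewrite def_xs mem_cat mem_head orbT.
all: have [bx|sx] := boolP (big x);
  first by apply: (bypass_count (u := u) (xs := xs)) => //;
    [rewrite cons_uniq uC | exact: no_2path].
all: have nax : ~~ e (last c cs) x
  by apply: contra sx => ax; apply: (dominated_big ax au);
    [exact: outside | rewrite adjC u_nonadj].
all: have nxc : ~~ e x c
  by apply: contra sx => xc; apply: (dominating_big xc vc);
    [exact: outside | rewrite adjC v_nonadj].
  by move: pxs; rewrite def_xs /= (negPf nax).
apply/negP => gx.
have [s1 [p [q [s2 [def_c py yq]]]]] : exists s1 p q s2,
    [/\ c :: cs = s1 ++ p :: q :: s2, e p y & e y q].
  by apply: not_gap_path; apply: IH pxs; rewrite def_xs cat_rcons.
have yx : e y x.
  move: pxs; rewrite def_xs cat_rcons rcons_cat cat_path.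
  by case/andP=> _ /= /and3P[].
have cs_q : q \in c :: cs by rewrite def_c mem_cat !inE eqxx !orbT.
have xcs : x \notin c :: cs by apply/negP => /(disj _ _ xs_x)/eqP.
have [cs1 [cs2 [def_cs lcs1]]] := mem_split_path cs_q.
have/orP[xq|qx] : adjacent e x q.
  by apply: contraNT sx => ?; apply: (dominated_big yx yq) => //; rewrite eq_sym disj.
- move/negP: nxc; apply; move: pcs gx xcs.
  rewrite def_cs !cat_path => /andP[p1 _] /andP[g1 _] xcs.
  apply: (small_gap_head sx _ p1 g1); last by rewrite lcs1.
  by apply: contra xcs; rewrite !inE mem_cat => /orP[->|->]; rewrite ?orbT.
move/negP: nax; apply; move: pcs gx xcs.
rewrite def_cs !cat_path last_cat lcs1 => /andP[_ p1] /andP[_ g1] xcs.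
apply: (small_gap_last sx _ p1 g1 qx).
rewrite inE negb_or eq_sym disj //=.
by apply: contra xcs; rewrite !inE mem_cat => ->; rewrite !orbT.
Qed.

Lemma minimal_bypass_absurd : False.
Proof.
have [w [ws [[cC UC pw wc wC] Uw]]] := bypass_uniq bypassC.
have [pcs pxs] := cycle_cat_cons cC.
have sorted_xs : sorted e xs.
  by move: pxs; case: (xs) => //= x xs' /andP[_]; rewrite rcons_path => /andP[].
have long xs' : sorted e xs' -> {subset xs' <= xs} -> uniq xs' ->
    has_cycle_of_length e (size xs' + size (c :: cs) + size (w :: ws)).
  move=> sxs' sub Uxs'.
  have [|[|c' cs'] [st' pt' ht' lt']] := @multi_insertion T e xs' (c :: cs) sxs' pcs.
  - by move=> y /sub/insertable.
  - by have := perm_size pt'; rewrite size_cat /= addnS.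
  have def_c : c' = c by have := ht' c.
  have def_l : last c' cs' = last c cs by have := lt' c; rewrite /= def_c.
  subst c'.
  exists ((c :: cs') ++ w :: ws); last by rewrite !size_cat (perm_size pt') size_cat.
  split; first by rewrite size_cat /= addnS.
    by apply: cycle_glue; rewrite ?def_l.
  have inC z : z \in c :: cs' -> z \in C.
    by rewrite (perm_mem pt') !mem_cat => /orP[/sub->|->]; rewrite ?orbT.
  rewrite cat_uniq Uw (perm_uniq pt') andbT; apply/andP; split.
    move: UC; rewrite !cat_uniq Uxs' => /and3P[_ dis ->]; rewrite andbT.
    by apply: contra dis => /hasP[z zc /sub xz]; apply/hasP; exists z.
  by apply/hasPn => z /wC; apply: contra => /inC.
have le_n : size C + size (w :: ws) <= #|T|.
  have UCw : uniq (C ++ w :: ws).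
    by rewrite cat_uniq UC Uw andbT; apply/hasPn => z /wC.
  by rewrite -size_cat -(card_uniqP UCw) max_card.
(* If the walk misses a vertex outside [C], reinserting all of [xs] still leaves the length below
   [#|T|]. *)
move: le_n; rewrite leq_eqVlt => /predU1P[eq_n|lt_n]; last first.
  apply: (no_cycle (k := size C + size (w :: ws))).
    by rewrite lt_n /= addnS ltnS leq_addr.
    rewrite /C size_cat; apply: long => //.
  by move: UC; rewrite cat_uniq => /andP[].
have Uxs : uniq xs by move: UC; rewrite cat_uniq => /andP[].
(* The walk covers everything outside [C], so the first vertex of [xs] is left out to obtain length
   [#|T| - 1]. *)
apply: (no_cycle (k := #|T|.-1)); first by move: two_outside; clear; lia.
move: eq_n xs_gt0 long sorted_xs Uxs; rewrite /C size_cat.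
case: (xs) => //= x xs' eq_n _ long sxs /andP[_ Uxs'].
have -> : #|T|.-1 = size xs' + size (c :: cs) + size (w :: ws) by rewrite -eq_n.
apply: long => //; first exact: path_sorted sxs.
by move=> z; rewrite inE orbC => ->.
Qed.

End MinimalBypass.
Lemma bypass_gap1 xs c cs u us (C := xs ++ c :: cs) :
    bypass xs c cs u us -> (size C).+2 <= #|T| ->
    (forall k, size C < k < #|T| -> ~ has_cycle_of_length e k) ->
  exists c' cs' u' us', bypass [::] c' cs' u' us' /\ size (c' :: cs') = size C.
Proof.
move=> bC leC; rewrite {}/C in leC * => noC.
have [n] := ubnP (size xs); elim: n => // n IHn in xs c cs u us bC leC noC *.
(* Under the negated goal, the induction hypothesis rules out every bypass with a shorter jump; this
   is the required minimality. *)
rewrite ltnS => le_n; apply: NNPP => nG.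
have [xs0|xs_gt0] := posnP (size xs).
  by apply: nG; exists c, cs, u, us; move/size0nil: xs0 bC => ->.
apply: (minimal_bypass_absurd leC bC) => // xs' c' cs' u' us' bC' eqC'.
rewrite leqNgt; apply/negP => lt_xs'; apply: nG; rewrite -eqC'.
by apply: IHn bC' _ _ _; rewrite ?eqC' ?(leq_trans lt_xs').
Qed.

Lemma bypass_exists C : strong e -> cycle e C -> uniq C -> 0 < size C < #|T| ->
  exists xs c cs u us, bypass xs c cs u us /\ size (xs ++ c :: cs) = size C.
Proof.
move=> strong_e cC UC /andP[C_gt0 C_ltn].
have [x xC]: exists x, x \in C by case: (C) C_gt0 => // x s; exists x; apply: mem_head.
have [y yC]: exists y, y \notin C.
  apply/existsP; apply: contraLR C_ltn; rewrite negb_exists -leqNgt => /forallP allC.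
  rewrite -(card_uniqP UC); apply/subset_leq_card/subsetP => z _.
  by have := allC z; rewrite negbK.
have [a [u [aC uC au]]]: exists a u, [/\ a \in C, u \notin C & e a u].
  have /connectP[p] := strong_e x y; elim: p x xC => [|z p IHp] x xC /=.
    by move=> _ eq_yx; rewrite eq_yx xC in yC.
  case/andP=> xz pz ly; have [zC|zC] := boolP (z \in C); first exact: IHp pz ly.
  by exists x, z.
have [us [b [pu lb bC usC]]]: exists us b, [/\ path e u us, e (last u us) b, b \in C &
    {in u :: us, forall z, z \notin C}].
  have /connectP[p] := strong_e u x; elim: p u uC {au} => [|z p IHp] u uC /=.
    by move=> _ eq_xu; rewrite -eq_xu xC in uC.
  case/andP=> uz pz lx; have [zC|zC] := boolP (z \in C).
    by exists [::], z; split=> //= w; rewrite inE => /eqP->.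
  have [us [b [pz' lb bC usC]]] := IHp z zC pz lx.
  exists (z :: us), b; split=> //=; first by rewrite uz.
  by move=> w; rewrite inE => /predU1P[->|/usC].
have [i s def_C] := rot_to aC.
(* Listing the exit vertex [a] last includes the case [b = a], where [cs] is empty. *)
have bs : b \in rcons s a by rewrite mem_rcons -def_C mem_rot.
have [xs [cs def_s]] := mem_split bs.
have defC : rot 1 (rot i C) = xs ++ b :: cs by rewrite def_C rot1_cons.
have last_a : last b cs = a.
  by have := last_rcons b s a; rewrite def_s last_cat.
exists xs, b, cs, u, us; split; last by rewrite -defC !size_rot.
split; rewrite -?defC ?rot_cycle ?rot_uniq //=; first by rewrite last_a au.
by move=> z /usC; rewrite !mem_rot.
Qed.

(** * Bypasses joining consecutive vertices of the cycle *)

Section SpanningBypass.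
Variables (cs us : seq T) (c u : T).
Let C := c :: cs.
Hypothesis C_gt1 : 1 < size C.
Hypothesis us_gt0 : 0 < size us.
Hypothesis bypassC : bypass [::] c cs u us.
Hypothesis uniq_us : uniq (u :: us).
Hypothesis spanning : size C + size (u :: us) = #|T|.
Hypothesis no_cycle : forall k,
  size C < k < #|T| -> ~ has_cycle_of_length e k.
Let v := last u us.

Let cC : cycle e C. Proof. by case: bypassC. Qed.
Let UC : uniq C. Proof. by case: bypassC. Qed.
Let a_u : e (last c cs) u. Proof. by case: bypassC => _ _ /andP[]. Qed.
Let p_us : path e u us. Proof. by case: bypassC => _ _ /andP[]. Qed.
Let v_c : e v c. Proof. by case: bypassC. Qed.
Let outC : {in u :: us, forall w, w \notin C}. Proof. by case: bypassC. Qed.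
Let uC : u \notin C. Proof. by rewrite outC ?mem_head. Qed.
Let vC : v \notin C. Proof. by rewrite outC ?mem_last. Qed.

Let no_detour xs b t w ws : perm_eq (xs ++ b :: t) C -> cycle e (xs ++ b :: t) ->
  path e (last b t) (w :: ws) -> e (last w ws) b -> uniq (w :: ws) ->
  {in w :: ws, forall z, z \notin C} ->
  size C < size (b :: t) + size (w :: ws) < #|T| -> False.
Proof.
move=> pC cD pw wb Uw wC /no_cycle; apply.
apply: (@bypass_cycle xs) => //; split; rewrite ?(perm_uniq pC) //.
by move=> z /wC; rewrite (perm_mem pC).
Qed.

Let gapC w : w \notin C -> cycle (gap e w) C.
Proof.
move=> wC; apply: contraT => nC.
case: (no_cycle _ (insert_cycle cC UC wC _ nC)) => //.
by move: spanning us_gt0; rewrite /=; clear; lia.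
Qed.

(** If [v] were small, [v -> c] would propagate backwards round the cycle to the successor [d] of
    [c]. Entering at [d] instead of [c] then gives a cycle of length [#|T| - 1]. *)
Let big_v : big v.
Proof.
apply: contraT => sv; have := gapC vC; have := cC; have := C_gt1.
have := no_detour; have := UC; have := vC; move: outC spanning a_u; rewrite /C.
case: (cs) => //= d t oC sz ltu vcC Ucs noD _ /andP[cd pdt] /andP[gcd gdt].
have vd : e v d.
  apply: (small_gap_head sv _ pdt gdt); last by rewrite last_rcons.
  by move: vcC; rewrite -rcons_cons mem_rcons.
case: (noD [:: c] d t u us) => //=.
- by rewrite cd.
- by rewrite ltu.
by move: sz us_gt0; clear; lia.
Qed.

Let big_u : big u.
Proof.
apply: contraT => su; have := gapC uC; have := cC; have := C_gt1.
have := no_detour; have := UC; have := uC; move: outC spanning a_u; rewrite /C.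
case/lastP: (cs) => // t a; rewrite /= last_rcons size_rcons => oC sz au ucC Ucs noD _.
rewrite !rcons_path !last_rcons => /andP[/andP[pt ta] ac] /andP[/andP[gt gta] gac].
have tu : e (last c t) u.
  apply: (@small_gap_last u a (c :: t)); rewrite //= ?ac ?gac //.
  by move: ucC; rewrite -rcons_cons mem_rcons.
case: (noD [:: a] c t u us) => //=.
- by rewrite -rcons_cons perm_sym perm_rcons.
- by rewrite ac rcons_path pt.
- by rewrite tu.
by move: sz us_gt0; clear; lia.
Qed.

Let perm_T : perm_eq (C ++ u :: us) (enum T).
Proof.
have UT : uniq (C ++ u :: us).
  by rewrite cat_uniq UC uniq_us andbT; apply/hasPn => z /outC.
have sub : {subset C ++ u :: us <= enum T} by move=> z; rewrite mem_enum.
have le : size (enum T) <= size (C ++ u :: us).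
  by rewrite -cardE size_cat spanning.
exact: uniq_perm UT (enum_uniq _) (uniq_min_size UT sub le).2.
Qed.

(** Skipping [s2] leaves a nonempty walk, so the resulting cycle is longer than [C] but not
    spanning. *)
Let no_shortcut s1 y s2 z s3 : u :: us = s1 ++ y :: s2 ++ z :: s3 ->
  0 < size s2 -> ~~ e y z.
Proof.
move=> def_us s2_gt0; apply/negP => yz.
have [w [ws def_ws]] : exists w ws, s1 ++ y :: z :: s3 = w :: ws.
  by case: (s1) => [|w s]; [exists y, (z :: s3) | exists w, (s ++ y :: z :: s3)].
have sub : subseq (w :: ws) (u :: us).
  rewrite -def_ws def_us cat_subseq //= eqxx.
  by rewrite -[z :: s3]cat0s cat_subseq ?sub0seq.
have lastE : last w ws = v.
  rewrite -[LHS]/(last w (w :: ws)) -def_ws -[v]/(last u (u :: us)) def_us.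
  by rewrite !(last_cat, last_cons).
have : path e (last c cs) (u :: us) by rewrite /= a_u.
rewrite def_us cat_path /= cat_path /= => /and5P[p1 p2 _ _ p3].
apply: (@no_detour [::] c cs w ws); rewrite ?lastE //.
- by rewrite -def_ws cat_path /= p1 p2 yz.
- exact: subseq_uniq sub uniq_us.
- by move=> x /(mem_subseq sub)/outC.
rewrite -spanning -def_ws def_us !size_cat /= !size_cat /=.
by move: s2_gt0; clear; lia.
Qed.

(** By [no_shortcut], [u] has at most one arc into [us], hence at most [size us + 1] arcs to or from
    it. With at most [size C] arcs at the cycle this only just reaches [#|T|], so both bounds are
    attained and every vertex of [us] has an arc to [u]. *)
Let full_u : size C <= arcs e u C /\ e v u.
Proof.
have := arcs_gap_cycle (gapC uC); move: big_u.
rewrite /big (deg_arcs e _ perm_T) arcs_cat -spanning /v.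
have nsc := no_shortcut; case: (us) us_gt0 nsc => // u2 t _ nsc.
have : count (e u) t = 0.
  apply/eqP; rewrite eqn0Ngt -has_count; apply/hasPn => y.
  case/mem_split=> s1 [s2 def_t].
  by apply: (@nsc [::] u (u2 :: s1) y s2); rewrite //= def_t.
rewrite arcs_cons loopless /arcs /= => -> big_deg le_C.
have : (e u2 u && all (e^~ u) t).
  rewrite all_count; have := count_size (e^~ u) t.
  by move: big_deg le_C; clear; case: (e u u2); case: (e u2 u) => /=; lia.
case/andP=> u2u tu; split; last first.
  by have := mem_last u2 t; rewrite inE => /predU1P[->//|/(allP tu)].
have := count_size (e^~ u) t.
by move: big_deg le_C; clear; case: (e u u2); case: (e u2 u) => /=; lia.
Qed.

Let full_v : size C <= arcs e v C.
Proof.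
move: big_v; rewrite /big (deg_arcs e _ perm_T) arcs_cat -spanning.
have [t [w def_us]] : exists t w, u :: us = rcons (rcons t w) v.
  rewrite /v; case/lastP: (us) us_gt0 => // us' v' _.
  by exists (belast u us'), (last u us'); rewrite last_rcons -lastI.
have : count (e^~ v) t = 0.
  apply/eqP; rewrite eqn0Ngt -has_count; apply/hasPn => y.
  case/mem_split=> s1 [s2 def_t].
  apply: (@no_shortcut s1 y (rcons s2 w) v [::]); last by rewrite size_rcons.
  by rewrite def_us def_t !(rcons_cat, rcons_cons) cats1.
rewrite def_us -!cats1 !arcs_cat !size_cat !arcs_cons loopless /arcs /= => ->.
have := count_size (e v) t; clear; case: (e v w); case: (e w v) => /=; lia.
Qed.

Let alt_u : cycle (fun a b => e u b == ~~ e a u) C.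
Proof. by case: full_u => full _; apply: arcs_full_cycle (gapC uC) full. Qed.

Let alt_v : cycle (fun a b => e v b == ~~ e a v) C.
Proof. exact: arcs_full_cycle (gapC vC) full_v. Qed.

(* If also [y -> b'], where [b'] follows [b], then replacing [b] by the path from
   [x] to [y] gives a cycle of forbidden length. *)
Let drop_one x ws (y := last x ws) :
    path e x ws -> 0 < size ws -> uniq (x :: ws) -> {subset x :: ws <= u :: us} ->
    cycle (fun a b => e y b == ~~ e a y) C ->
  cycle (fun a b => e a x ==> e b y) C.
Proof.
move=> pw ws_gt0 Uw sub alt_y; apply: rot_cycleP => // i a b t def_C.
apply/implyP => ax; apply: contraT => nby.
have [d [s def_s]] : exists d s, rcons t a = d :: s.
  by case: (t) => [|d s]; do 2!eexists.
have last_s : last d s = a by have := last_rcons b t a; rewrite def_s.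
have def_C' : rot 1 (rot i C) = b :: d :: s by rewrite def_C rot1_cons rcons_cons def_s.
have /= /andP[/eqP yd _] : path (fun a b => e y b == ~~ e a y) b (rcons (d :: s) b).
  by move: alt_y; rewrite -(rot_cycle i) -(rot_cycle 1) def_C'.
have := uniq_leq_size Uw sub; rewrite /= => le_size.
have sizeC : size C = (size s).+2 by rewrite -(size_rot i) -(size_rot 1) def_C'.
case: (@no_detour [:: b] d s x ws) => //.
- by rewrite -[_ ++ _]/[:: b, d & s] -def_C' !perm_rot.
- by rewrite -[_ ++ _]/[:: b, d & s] -def_C' !rot_cycle.
- by rewrite /= last_s ax.
- by rewrite yd nby.
- by move=> z /sub/outC.
move: ws_gt0 le_size; rewrite -spanning sizeC /=; clear; lia.
Qed.

Let u_v : u != v.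
Proof.
rewrite /v; case: (us) us_gt0 uniq_us => // x s _ /andP[+ _].
by apply: contraNneq => -> /=; rewrite mem_last.
Qed.

Let to_v : cycle (fun a b => e a u ==> e b v) C.
Proof. exact: drop_one alt_v. Qed.

Let to_u : cycle (fun a b => e a v ==> e b u) C.
Proof.
case: full_u => _ vu; apply: (@drop_one v [:: u]); rewrite /= ?vu ?inE 1?eq_sym ?u_v //.
by move=> z; rewrite !inE => /orP[] /eqP->; rewrite ?eqxx // -in_cons mem_last.
Qed.

(** By [to_u] and [to_v], having arcs to both of [u], [v] and having an arc to at least one both
    propagate round [C]. The vertex [last c cs] has an arc to [u] but, since [v -> c], none to
    [v]. *)
Let one_of : {in C, forall a, e a v = ~~ e a u}.
Proof.
have last_C : last c cs \in C by rewrite mem_last.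
have last_v : ~~ e (last c cs) v.
  have := gapC vC; rewrite /= rcons_path => /andP[_].
  by rewrite /gap v_c andbT.
have both : cycle (fun a b => e a u && e a v ==> e b u && e b v) C.
  have : cycle [rel a b | (e a u ==> e b v) && (e a v ==> e b u)] C.
    by rewrite cycle_relI to_u to_v.
  apply: sub_cycle => a b /=.
  by case: (e a u); case: (e a v); case: (e b u); case: (e b v).
have some : cycle (fun a b => e a u || e a v ==> e b u || e b v) C.
  have : cycle [rel a b | (e a u ==> e b v) && (e a v ==> e b u)] C.
    by rewrite cycle_relI to_u to_v.
  apply: sub_cycle => a b /=.
  by case: (e a u); case: (e a v); case: (e b u); case: (e b v).
move=> a aC; have := cycle_all some last_C; rewrite a_u => /(_ isT a aC).
have : ~~ (e a u && e a v).
  apply: contra last_v => auv.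
  by have /(_ auv _ last_C)/andP[] := cycle_all both aC.
by case: (e a u); case: (e a v).
Qed.

Let alternate : cycle (fun a b => e b u == ~~ e a u) C.
Proof.
have : cycle [rel a b | (e a u ==> e b v) && (e a v ==> e b u)] C.
  by rewrite cycle_relI to_u to_v.
apply: (@sub_in_cycle _ (mem C)); last by apply/allP.
move=> a b aC bC; rewrite /= (one_of aC) (one_of bC).
by case: (e a u); case: (e b u).
Qed.

(** Both sides are the negation of [e a u] for the predecessor [a] on the cycle. *)
Let sym_u : {in C, forall a, e u a = e a u}.
Proof.
move=> b bC.
have : cycle [rel a b | (e u b == ~~ e a u) && (e b u == ~~ e a u)] C.
  by rewrite cycle_relI alt_u alternate.
by case/cycle_pred/(_ bC) => a _ /andP[/eqP-> /eqP->].
Qed.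

Let sym_v : {in C, forall a, e v a = e a v}.
Proof.
move=> b bC.
have : cycle [rel a b | (e v b == ~~ e a v) && (e b u == ~~ e a u)] C.
  by rewrite cycle_relI alt_v alternate.
case/cycle_pred/(_ bC) => a aC /andP[/eqP-> /eqP].
by rewrite !one_of // => ->.
Qed.

Lemma spanning_bypass : exists w, [/\ us = [:: w], e u w /\ e w u,
  cycle (fun a b => e b u == ~~ e a u) C,
  {in C, forall a, [/\ e a w = ~~ e a u, e u a = e a u & e w a = e a w]} &
  (count (e^~ u) C).*2 = size C].
Proof.
have [full vu] := full_u.
have cu : e c u = false.
  by have := alternate; rewrite /= rcons_path a_u => /andP[_ /eqP].
have cC' : c \in C by rewrite mem_head.
have def_us : us = [:: v].
  suff: size us <= 1 by rewrite /v; case: (us) us_gt0 => [|w []].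
  (* If [us] had two vertices, the detour from [c] through [v] and [u] to its successor [d] would
     give a cycle of length [size C + 2], below [#|T|]. *)
  rewrite leqNgt; apply/negP => us_gt1.
  have [d [t def_cs]] : exists d t, cs = d :: t.
    by move: C_gt1; rewrite /C; case: (cs) => // d t; exists d, t.
  have dC : d \in C by rewrite /C def_cs !inE eqxx orbT.
  have defC : rot 1 C = [::] ++ d :: rcons t c by rewrite /C def_cs rot1_cons.
  have := alternate; rewrite {1}/C {1}def_cs /= => /andP[/eqP du _].
  apply: (@no_detour [::] d (rcons t c) v [:: u]); rewrite -?defC ?rot_cycle //.
  - by rewrite perm_rot.
  - by rewrite last_rcons /= vu one_of // cu.
  - by rewrite /= sym_u // du cu.
  - by rewrite /= inE eq_sym u_v.
  - by move=> z; rewrite !inE => /orP[] /eqP->.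
  rewrite -[size (_ :: rcons _ _)]/(size ([::] ++ d :: rcons t c)) -defC size_rot.
  by move: us_gt1; rewrite -spanning /=; clear; lia.
exists v; split; rewrite ?def_us //.
- by move: p_us; rewrite {1}def_us /= => /andP[].
- by move=> a aC; split; [exact: one_of | exact: sym_u | exact: sym_v].
have := arcs_gap_cycle (gapC uC); rewrite /arcs (eq_in_count sym_u) addnn => le_C.
by apply/eqP; rewrite eqn_leq le_C; move: full; rewrite /arcs (eq_in_count sym_u) addnn.
Qed.

End SpanningBypass.

Lemma spanning_bypass_DB cs c u us (C := c :: cs) :
    1 < size C -> 0 < size us -> bypass [::] c cs u us -> uniq (u :: us) ->
    size C + size (u :: us) = #|T| ->
    (forall k, size C < k < #|T| -> ~ has_cycle_of_length e k) ->
  ~~ odd #|T| /\ in_DB e.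
Proof.
rewrite {}/C => C_gt1 us_gt0 bC Uus sizeT noC.
have [v [def_us [uv vu] alt sym half]] := spanning_bypass C_gt1 us_gt0 bC Uus sizeT noC.
subst us; set C := c :: cs in C_gt1 sizeT noC alt sym half.
have [cC UC outC] : [/\ cycle e C, uniq C & {in [:: u; v], forall w, w \notin C}].
  by case: bC.
have uC : u \notin C by rewrite outC ?mem_head.
have vC : v \notin C by rewrite outC // !inE eqxx orbT.
have UT : uniq (C ++ [:: u; v]).
  by rewrite cat_uniq Uus andbT UC; apply/hasPn => z /outC.
have perm_T : perm_eq (C ++ [:: u; v]) (enum T).
  have sub : {subset C ++ [:: u; v] <= enum T} by move=> z; rewrite mem_enum.
  have le : size (enum T) <= size (C ++ [:: u; v]) by rewrite -cardE size_cat sizeT.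
  exact: uniq_perm UT (enum_uniq _) (uniq_min_size UT sub le).2.
have caseT y : [\/ y \in C, y = u | y = v].
  have : y \in enum T by rewrite mem_enum.
  rewrite -(perm_mem perm_T) mem_cat !inE.
  by case/or3P=> [yC|/eqP->|/eqP->]; [constructor 1 | constructor 2 | constructor 3].
(* The parts are the in-neighbors of [u] and the remaining vertices. *)
have bipartite x y : e x y = (e x u != e y u).
  have [xC|->|->] := caseT x; last 2 first.
  - have [yC|->|->] := caseT y; rewrite ?loopless ?uv ?vu //.
    by have [_ -> _] := sym _ yC; case: (e y u).
  - have [yC|->|->] := caseT y; rewrite ?loopless ?uv ?vu //.
    by have [yv _ ->] := sym _ yC; rewrite yv; case: (e y u).
  have [yC|->|->] := caseT y; rewrite ?loopless ?uv ?vu //; last 2 first.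
  - by case: (e x u).
  - by have [-> _ _] := sym _ xC; case: (e x u).
  have [<-|neq_xy] := eqVneq x y; first by rewrite loopless eqxx.
  have [i s def_C] := rot_to xC.
  case: s def_C => [|b t] def_C; first by move: C_gt1; rewrite -(size_rot i) def_C.
  have ybt : y \in b :: t.
    by move: yC; rewrite -(mem_rot i) def_C inE eq_sym (negPf neq_xy).
  have sub_bt z : z \in x :: b :: t -> z \in C by rewrite -def_C mem_rot.
  have b_C : b \in C by rewrite sub_bt // !inE eqxx orbT.
  have l_C : last b t \in C by rewrite sub_bt // in_cons mem_last orbT.
  have size_bt : size (b :: t) = (size C).-1 by rewrite -(size_rot i C) def_C.
  have := alt; rewrite -(rot_cycle i) def_C /= rcons_path.
  case/and3P=> /eqP bu _ /eqP xu.
  have := cC; rewrite -(rot_cycle i) def_C /= rcons_path.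
  case/and3P=> xb pbt lx.
  have := UC; rewrite -(rot_uniq i) def_C cons_uniq.
  case/andP=> xbt Ubt.
  (* Exchange [x] and [w] in the cycle: the bypass [x w'] of the new cycle
     satisfies the same hypotheses. *)
  have replace w w' : w \in [:: u; v] -> w' \in [:: u; v] -> w != w' ->
      e w w' -> e w' w -> e x w' -> e w b -> e (last b t) w ->
      e y w' = ~~ e y x /\ e x y = e y x.
    move=> wuv w'uv neq_w ww' w'w xw' wb lw.
    have wC : w \notin C by move: wuv; rewrite !inE => /orP[] /eqP->.
    have w'C : w' \notin C by move: w'uv; rewrite !inE => /orP[] /eqP->.
    have xw : x != w by apply: contraNneq wC => <-.
    have xw'' : x != w' by apply: contraNneq w'C => <-.
    have wbt : w \notin b :: t.
      by apply: contra wC => h; rewrite sub_bt // in_cons h orbT.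
    have w'bt : w' \notin b :: t.
      by apply: contra w'C => h; rewrite sub_bt // in_cons h orbT.
    have [||||||w2 [[->] _ _ + _]] := @spanning_bypass (b :: t) [:: w'] w x.
    - by rewrite /= ltnS.
    - by [].
    - split; last 1 first.
      + move=> z; rewrite !inE => /orP[] /eqP->; rewrite negb_or ?xw //.
        by rewrite [_ == w]eq_sym neq_w.
      + by rewrite /= wb rcons_path pbt.
      + by rewrite cat0s cons_uniq wbt.
      + by rewrite /= lx xw'.
      by [].
    - by rewrite /= inE xw''.
    - by rewrite -sizeT -[size (w :: _)]/(size (b :: t)).+1 size_bt prednK // ltnW.
    - by rewrite -[size (w :: _)]/(size (b :: t)).+1 size_bt prednK // ltnW.
    by move=> /(_ y); rewrite in_cons ybt orbT => /(_ isT)[].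
  have [bv _ _] := sym _ b_C; have [_ sbu sbv] := sym _ b_C.
  have [lv _ _] := sym _ l_C; have [xv _ _] := sym _ xC; have [yv _ _] := sym _ yC.
  have neq_uv : u != v by apply: contraTneq uv => ->; rewrite loopless.
  (* The vertex with the same neighbors on [C] as [x] replaces it: [v] if [x -> u], and [u]
     otherwise. *)
  case exu: (e x u) in xu bu xv *.
    have [||||||||-> ->] := replace v u; rewrite ?inE ?eqxx ?orbT 1?eq_sym //.
    - by rewrite sbv bv bu.
    - by rewrite lv -xu.
    by case: (e y x).
  have [||||||||+ ->] := replace u v; rewrite ?inE ?eqxx ?orbT //.
  - by rewrite sbu bu.
  - by move: xu; case: (e (last b t) u).
  by rewrite yv; case: (e y x); case: (e y u).
(* The extra 1 counts [v]; with [half] this is half of all vertices. *)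
have cardB : #|[set y | e y u]| = (count (e^~ u) C).+1.
  rewrite cardsE cardE size_filter.
  have /permP := perm_T; rewrite enumT => <-.
  by rewrite count_cat /= !unfold_in loopless vu addn1.
have cardA : #|~: [set y | e y u]| = (count (e^~ u) C).+1.
  have := cardsC [set y | e y u]; rewrite cardB -sizeT -half.
  by move: (count _ _); clear => k /=; lia.
split.
  by rewrite -sizeT -half oddD odd_double.
split; first by move: sizeT C_gt1 => /=; clear; lia.
exists [set y | e y u]; split.
- by rewrite cardA cardB.
- by move=> x y; rewrite !inE => xu yu; rewrite (bipartite x y) xu yu.
- by move=> x y; rewrite !inE => /negPf xu /negPf yu; rewrite (bipartite x y) xu yu.
move=> x y; rewrite !inE => xu /negPf yu.
by rewrite (bipartite x y) (bipartite y x) xu yu.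
Qed.

Hypothesis strong_e : strong e.

Lemma longer_cycle C : dicycle e C -> (size C).+2 <= #|T| ->
  (exists2 k, size C < k < #|T| & has_cycle_of_length e k) \/
  ~~ odd #|T| /\ in_DB e.
Proof.
case=> C_gt1 cC UC C_lt; apply: NNPP => no_goal.
have noC k : size C < k < #|T| -> ~ has_cycle_of_length e k.
  by move=> ltk Ck; apply: no_goal; left; exists k.
have C_range : 0 < size C < #|T| by rewrite (ltnW C_gt1) ltnW.
have [xs [c0 [cs0 [u0 [us0 [b0 eq0]]]]]] := bypass_exists strong_e cC UC C_range.
rewrite -eq0 in C_gt1 C_lt noC.
have [c [cs [w [ws [bw eqC]]]]] := bypass_gap1 b0 C_lt noC.
rewrite -eqC in C_gt1 C_lt noC.
have [u [us [bC Uu]]] := bypass_uniq bw.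
(* Since nothing is jumped over, this cycle contains all of [C] and the walk; it must be
   spanning. *)
have := bypass_cycle bC Uu; set k := _ + _ => Ck.
have k_le : k <= #|T| by case: Ck => D [_ _ /card_uniqP <-] <-; apply: max_card.
move: k_le; rewrite leq_eqVlt => /predU1P[eqk|ltk]; last first.
  by apply: noC Ck; rewrite ltk /k addnS ltnS leq_addr.
apply: no_goal; right; apply: spanning_bypass_DB bC _ _ noC => //.
by move: C_lt; rewrite -eqk /k /=; clear; lia.
Qed.

Lemma almost_spanning_cycle C : dicycle e C -> size C < #|T| ->
  has_cycle_of_length e (#|T| - 1) \/ ~~ odd #|T| /\ in_DB e.
Proof.
have [k] := ubnP (#|T| - size C); elim: k C => // k IHk C lek dC ltC.
have [eqC|ltC'] : size C = #|T| - 1 \/ (size C).+2 <= #|T|.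
- by move: ltC; clear; lia.
- by left; exists C.
have [[j /andP[ltCj ltj] [D dD szD]]|] := longer_cycle dC ltC'; last by right.
by apply: (IHk D); rewrite ?szD //; move: lek ltC ltj ltCj; clear; lia.
Qed.

(** * Digraphs all of whose cycles are Hamiltonian *)

Lemma dicycle_exists : 1 < #|T| -> exists C, dicycle e C.
Proof.
case/card_gt1P=> x [y [_ _ neq_xy]].
have /connectP[[|z p] /=] := strong_e x y.
  by move=> _ eq_yx; rewrite eq_yx eqxx in neq_xy.
case/andP=> xz _ _; have /connectP[q] := strong_e z x.
case/shortenP => q' pq' Uq' _ def_x; exists (z :: q'); split=> //.
  by case: q' {pq' Uq'} def_x => //= eq_xz; rewrite eq_xz loopless in xz.
by rewrite /= rcons_path pq' -def_x xz.
Qed.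

(** An arc that skips vertices of the Hamiltonian cycle would close a shorter cycle. *)
Lemma spanning_cycle_arcs C : dicycle e C -> size C = #|T| ->
  (forall D, dicycle e D -> #|T| <= size D) ->
  forall x y, e x y = (y == next C x).
Proof.
case=> _ cC UC szC girth x y.
have inC z : z \in C.
  have [_ ->] : (size C = size (enum T)) * (C =i enum T).
    apply: uniq_min_size => //; first by move=> w; rewrite mem_enum.
    by rewrite szC cardE.
  by rewrite mem_enum.
apply/idP/eqP => [xy|->]; last by rewrite next_cycle.
have [i s def_C] := rot_to (inC x).
have : y \in x :: s by rewrite -def_C mem_rot.
rewrite inE => /predU1P[eq_yx|sy]; first by rewrite eq_yx loopless in xy.
rewrite -(next_rot i) // def_C; case/mem_split: sy => s1 [s2 def_s].
have s1_nil : s1 = [::].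
  case: s1 def_s => // z s1 def_s.
  have dD : dicycle e (x :: y :: s2).
    split=> //.
      have := cC; rewrite -(rot_cycle i) def_C def_s /= xy.
      by rewrite rcons_cat rcons_cons cat_path => /and3P[_ _ /= /andP[_ ->]].
    have := UC; rewrite -(rot_uniq i) def_C def_s; apply: subseq_uniq.
    exact: cat_subseq (subseq_refl [:: x]) (suffix_subseq (z :: s1) (y :: s2)).
  have := girth _ dD; rewrite -szC -(size_rot i) def_C def_s /= size_cat /=.
  by clear; lia.
by rewrite def_s s1_nil /= eqxx.
Qed.

Lemma directed_cycle_isomorphic : 1 < #|T| ->
  (forall C, dicycle e C -> #|T| <= size C) ->
  isomorphic e (@directed_cycle #|T|).
Proof.
move=> T_gt1 girth; have [C dC] := dicycle_exists T_gt1.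
have [_ cC UC] := dC.
have szC : size C = #|T|.
  by apply/eqP; rewrite eqn_leq girth // -(card_uniqP UC) max_card.
have arcE := spanning_cycle_arcs dC szC girth.
case: C => [|c cs] in dC cC UC szC arcE *; first by rewrite -szC in T_gt1.
pose g (i : 'I_#|T|) := nth c (c :: cs) i.
have g_inj : injective g.
  by move=> i j /eqP; rewrite nth_uniq ?szC // => /eqP/ord_inj.
have [f fK gK] : bijective g by apply: inj_card_bij g_inj _; rewrite card_ord.
have arc_g i : e (g i) (g (ordS i)).
  have lt_size : i < size (rcons cs c).
    by rewrite size_rcons -[i < _]/(i < size (c :: cs)) szC.
  have := cC => /= /(pathP c)/(_ i lt_size).
  rewrite /g -[c :: rcons _ _]/(rcons (c :: cs) c).
  rewrite !nth_rcons szC ltn_ord /=.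
  have : i <= size cs by rewrite -ltnS -[(size cs).+1]/(size (c :: cs)) szC.
  (* The last index wraps around to the copy of [c] appended by [rcons]. *)
  rewrite leq_eqVlt => /predU1P[eq_i|lt_i].
    have -> : i.+1 %% #|T| = 0 by rewrite eq_i -[(size cs).+1]/(size (c :: cs)) szC modnn.
    by rewrite eq_i ltnn eqxx.
  have lt_iT : i.+1 < size (c :: cs) by [].
  by rewrite szC in lt_iT; rewrite lt_i modn_small.
exists f; split; first by exists g.
move=> x y; rewrite -{1}(gK x) -{1}(gK y) arcE /directed_cycle.
have := arc_g (f x); rewrite arcE => /eqP <-.
by rewrite (inj_eq g_inj).
Qed.

End DegreeCondition.

(** * The directed cycle *)

Section DirectedCycle.
Variable n : nat.
Hypothesis n_gt3 : 3 < n.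

(** Every in- and out-neighborhood has at most one vertex. *)
Lemma functional_locally_semicomplete (T : finType) (e : rel T) (g : T -> T) :
  injective g -> (forall x y, e x y = (y == g x)) -> locally_semicomplete e.
Proof.
move=> g_inj eE x; split=> a b; rewrite !inE !eE => /eqP xa /eqP xb; case/eqP.
  by apply: g_inj; rewrite -xa.
by rewrite xa.
Qed.

Lemma directed_cycle_val (i j : 'I_n) :
  directed_cycle i j = (j == i.+1 %[mod n]).
Proof. by rewrite /directed_cycle -val_eqE /= [j %% n]modn_small. Qed.

Lemma directed_cycle_irr : irreflexive (@directed_cycle n).
Proof.
move=> i; rewrite directed_cycle_val -addn1 -{1}[val i]addn0 eqn_modDl mod0n.
by rewrite modn_small // ltnW // ltnW.
Qed.

Lemma directed_cycle_local_tournament : local_tournament (@directed_cycle n).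
Proof.
split; first exact: functional_locally_semicomplete (@ordS_inj n) _.
move=> i j; rewrite !directed_cycle_val; apply/negP => /andP[/eqP ij ji].
move: ji; rewrite -addn1 -modnDml ij modnDml addn1 -addn2 -{1}[val i]addn0.
by rewrite eqn_modDl mod0n modn_small // ltnW.
Qed.

Lemma directed_cycle_degree (i : 'I_n) :
  outdeg (@directed_cycle n) i = 1 /\ indeg (@directed_cycle n) i = 1.
Proof.
rewrite /outdeg /indeg; split; rewrite -[RHS](cards1 i).
  have -> : out_nbr (@directed_cycle n) i = [set ordS i].
    by apply/setP => j; rewrite !inE.
  by rewrite !cards1.
have -> : in_nbr (@directed_cycle n) i = [set ord_pred i].
  apply/setP => j; rewrite !inE /directed_cycle.
  by rewrite -(can2_eq (@ord_predK n) (@ordSK n)) eq_sym.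
by rewrite !cards1.
Qed.

Lemma directed_cycle_round : round (@directed_cycle n).
Proof.
exists (cast_ord (card_ord n)); split.
  by exists (cast_ord (esym (card_ord n))) => i; apply: val_inj.
move=> i j; have [-> ->] := directed_cycle_degree (cast_ord (card_ord n) i).
rewrite !directed_cycle_val /=.
have modE (k l : nat) : (k = l %[mod #|'I_n|]) = (k = l %[mod n]) by rewrite card_ord.
have one (P : nat -> Prop) : (exists2 k, 0 < k <= 1 & P k) <-> P 1.
  split; last by exists 1.
  by case=> k; rewrite andbC -eqn_leq => /eqP->.
split; rewrite one addn1 modE; split.
- by move/eqP.
- by move/eqP.
- by move/eqP.
by move/eqP; rewrite eq_sym.
Qed.

(** Each vertex is blown up to a single point, so the girth condition becomes [3 < n]; the girth is
    carried over by the isomorphism. *)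
Lemma isomorphic_in_DL (T : finType) (e : rel T) :
    strong e ->
    has_cycle_of_length e n -> (forall C, dicycle e C -> n <= size C) ->
  isomorphic e (@directed_cycle n) -> in_DL e.
Proof.
move=> strong_e has_n girth_e [f [bij_f f_arc]].
have f_inj := bij_inj bij_f; case: (bij_f) => h hK fK.
have lsd_e : locally_semicomplete e.
  apply: (@functional_locally_semicomplete _ _ (fun x => h (ordS (f x)))).
    by move=> x y /(can_inj fK)/ordS_inj/f_inj.
  by move=> x y; rewrite f_arc -(can_eq hK) fK.
split=> //; exists n, (@directed_cycle n), (fun=> unit), (fun _ _ _ => false), n.
split; [split|split].
- exact: directed_cycle_irr.
- exact: directed_cycle_round.
- exact: directed_cycle_local_tournament.
- move=> i; split=> //; first by rewrite card_unit.
  by move=> [] [].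
split.
- split.
    case: has_n => C [C_gt1 cC UC] szC; exists (map f C); last by rewrite size_map.
    split; rewrite ?size_map ?map_inj_uniq //.
    by rewrite cycle_map; apply: sub_cycle cC => x y; rewrite /= f_arc.
  move=> C [C_gt1 cC UC]; rewrite -(size_map h); apply: girth_e.
  split; rewrite ?size_map ?map_inj_uniq //; last exact: can_inj fK.
  by rewrite cycle_map; apply: sub_cycle cC => x y; rewrite /= f_arc !fK.
- apply: leq_ltn_trans n_gt3; rewrite ltnS geq_max /=.
  by apply/bigmax_leqP => i _; rewrite card_unit.
exists (fun x => existT (fun=> unit) (f x) tt); split.
  exists (fun t : {i : 'I_n & unit} => h (tag t)) => [x|[i []]] /=; first exact: hK.
  by rewrite fK.
move=> x y; rewrite f_arc /composition /=; case: eqP => // ->.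
by rewrite directed_cycle_irr.
Qed.

End DirectedCycle.

Theorem theorem1p5 (T : finType) (e : rel T)
    (loopless : irreflexive e)
    (order_ge4 : 4 <= #|T|)
    (strong_e : strong e)
    (degree_cond : forall u : T,
        (exists v : T, nonadjacent_dominating_pair e u v \/
                       nonadjacent_dominated_pair e u v) ->
        #|T| <= deg e u) :
  has_cycle_of_length e (#|T| - 1)
  \/ (~~ odd #|T| /\ in_DB e)
  \/ (isomorphic e (@directed_cycle #|T|) /\ in_DL e).
Proof.
have T_gt1 : 1 < #|T| by apply: leq_trans order_ge4.
have [[C dC ltC]|no_short] := classic (exists2 C, dicycle e C & size C < #|T|).
  have [|] := almost_spanning_cycle loopless degree_cond strong_e dC ltC; first by left.
  by right; left.
have girth C : dicycle e C -> #|T| <= size C.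
  by move=> dC; rewrite leqNgt; apply/negP => ltC; apply: no_short; exists C.
have iso := directed_cycle_isomorphic loopless strong_e T_gt1 girth.
right; right; split=> //.
apply: (isomorphic_in_DL order_ge4 strong_e _ girth iso).
have [C dC] := dicycle_exists loopless strong_e T_gt1.
exists C => //; apply/eqP; rewrite eqn_leq girth // andbT.
by case: dC => _ _ /card_uniqP <-; apply: max_card.
Qed.
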